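(* Let $G$ be a strongly connected unweighted digraph without loops, let $H$ be its undirectization, let $0<\tau\le1$, and let $M_\tau(t)=I-At+(D-\tau I)\tau t^2+(A-S)\tau^2t^3$. If $H$ has at least two cycles, then $M_\tau(t)$ has at least one real eigenvalue in the open interval $(0,1/\tau)$.
   Context: $G=(V,E)$ with adjacency matrix $A$, $S=A\circ A^T$, $D=\mathrm{diag}(\mathrm{diag}(A^2))$. The undirectization $H$ is the undirected simple graph with edge $\{i,j\}$ whenever $(i,j)\in E$ or $(j,i)\in E$; a cycle is a closed path of length $\ge3$ up to cyclic permutations and reversal. Eigenvalues of $M_\tau(t)$ are roots of $\det M_\tau(t)$. Strongly connected: every vertex reachable from every other by a directed walk. *)

(* Defs.v *)
From HB Require Import structures.
From mathcomp Require Import all_boot all_order all_algebra.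
From mathcomp Require Import reals.
Set Implicit Arguments. Unset Strict Implicit. Unset Printing Implicit Defensive.
Import Order.TTheory GRing.Theory Num.Theory.
Local Open Scope ring_scope.

Definition adjmx (R : nzRingType) (n : nat) (E : rel 'I_n) : 'M[R]_n :=
  \matrix_(i, j) (E i j)%:R.

Definition symmx (R : nzRingType) (n : nat) (A : 'M[R]_n) : 'M[R]_n :=
  \matrix_(i, j) (A i j * A^T i j).

Definition diagsq (R : nzRingType) (n : nat) (A : 'M[R]_n) : 'M[R]_n :=
  \matrix_(i, j) ((i == j)%:R * (A *m A) i i).

Definition Mtau (R : comNzRingType) (n : nat) (E : rel 'I_n) (tau t : R)
  : 'M[R]_n :=
  let A := adjmx R E in
  1%:M - t *: A + (tau * t ^+ 2) *: (diagsq A - tau%:M)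
    + (tau ^+ 2 * t ^+ 3) *: (A - symmx A).

Definition loopless (n : nat) (E : rel 'I_n) : Prop := forall i, ~~ E i i.

Definition strongly_connected (n : nat) (E : rel 'I_n) : Prop :=
  forall x y, connect E x y.

Definition undir (n : nat) (E : rel 'I_n) : rel 'I_n :=
  fun i j => (i != j) && (E i j || E j i).

Definition is_cycle_seq (n : nat) (E : rel 'I_n) (s : seq 'I_n) : bool :=
  [&& (3 <= size s)%N, uniq s & cycle (undir E) s].

Definition same_cycle (n : nat) (s t : seq 'I_n) : Prop :=
  exists k, t = rot k s \/ t = rot k (rev s).

Definition two_cycles (n : nat) (E : rel 'I_n) : Prop :=
  exists s t, [/\ is_cycle_seq E s, is_cycle_seq E t & ~ same_cycle s t].

(* Main.v *)
Require Import Defs.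
From HB Require Import structures.
From mathcomp Require Import all_boot all_order all_algebra.
From mathcomp Require Import boolp reals polyrcf zify ring lra.
Import Order.TTheory GRing.Theory Num.Theory.
Set Implicit Arguments.
Unset Strict Implicit.
Local Open Scope ring_scope.

(** Put s = tau t, so that M = (1 - s^2)(I - t A) + t s (D - s S). On [0, 1) all
    off-diagonal entries of M are nonpositive, and M = I at s = 0. If M were
    nonsingular on (0, 1), the row vector 1 adj(M) would stay positive there:
    at the first zero of one of its entries, the corresponding entry of
    1 adj(M) M = det(M) 1 would be nonpositive. Dividing by the common power of
    1 - s yields a nonzero limit u >= 0 at s = 1 with u (D - S) >= 0, so the set
    W where u is minimal is a union of components of the graph of reciprocal
    edges. The vector 1_W is then killed by D - S, and the first-order term of
    M 1_W at s = 1 gives u (2 I - 2 A + D) 1_W >= 0. If W were not everything,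
    this would contradict the existence of a spanning forest of W directed away
    from its complement. Hence u is constant and H has at most n edges, while a
    connected graph with two cycles has at least n + 1. *)

(** * Edge counts in connected graphs and in graphs with two cycles *)

Section EdgeCounting.
Variable T : finType.
Implicit Types (e : rel T) (K : {set T}) (s t : seq T).

(** Ordered pairs: an edge of a symmetric irreflexive relation gives two arcs, whence the factors 2
    below. *)
Definition arcs e : {set T * T} := [set p | e p.1 p.2].

Lemma card_arcs e : #|arcs e| = (\sum_i \sum_j e i j)%N.
Proof.
rewrite -sum1_card big_mkcond /= pair_big /=.
by apply: eq_bigr => p _; rewrite inE; case: (e _ _).
Qed.

Lemma connect_crossing e (L : {set T}) x y :
  connect e x y -> x \in L -> y \notin L ->
  exists i j, [/\ i \in L, j \notin L & e i j].
Proof.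
case/connectP=> p; elim: p x => [|z p IHp] x /=; first by move=> _ -> ->.
case/andP=> exz pz yl xL yL; have [zL|zL] := boolP (z \in L).
  exact: IHp pz yl zL yL.
by exists x, z.
Qed.

(* Grow K one vertex at a time: each new vertex brings an arc and its reverse. *)
Lemma forest_bound e K : symmetric e ->
  (forall L : {set T}, K \subset L -> L != setT ->
     exists i j, [/\ i \in L, j \notin L & e i j]) ->
  (2 * #|~: K| <= #|[set p in arcs e | ~~ ((p.1 \in K) && (p.2 \in K))]|)%N.
Proof.
move=> esym; have [m] := ubnP #|~: K|; elim: m K => // m IHm K Km grow.
have [->|KnT] := eqVneq K setT; first by rewrite setCT cards0.
have [i [j [iK jK eij]]] := grow K (subxx _) KnT.
have ij : i != j by apply: contraNneq jK => <-.
have cardK : #|~: K| = (#|~: (j |: K)|.+1)%N.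
  by rewrite (cardsD1 j) inE jK setCU setIC setDE.
have {}IHm : (2 * #|~: (j |: K)| <= #|[set p in arcs e |
    ~~ ((p.1 \in j |: K) && (p.2 \in j |: K))]|)%N.
  apply: IHm; first by lia.
  move=> L KL; apply: grow; apply: subset_trans KL; exact: subsetUr.
rewrite cardK mulnS; apply: leq_trans (leq_add (leqnn 2) IHm) _.
have <- : #|[set (i, j); (j, i)]| = 2%N.
  by rewrite cards2 xpair_eqE negb_and ij.
rewrite -cardsUI [X in (_ + X <= _)%N]eq_card0 ?addn0.
  apply: subset_leq_card; apply/subsetP=> -[a b]; rewrite !inE /=.
  rewrite !xpair_eqE => /orP[/orP[]/andP[/eqP-> /eqP->]|].
  - by rewrite eij (negPf jK) andbF.
  - by rewrite esym eij (negPf jK).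
  - case/andP=> ->; rewrite /= !negb_and !negb_or.
    by move=> /orP[]/andP[_ ->]; rewrite ?orbT.
move=> [a b]; rewrite !inE /= !xpair_eqE.
apply/negbTE; apply/negP=> /andP[/orP[]/andP[/eqP-> /eqP->]];
  by rewrite !eqxx iK !orbT andbF.
Qed.

(** Spanning tree bound: grown from [[set x0]], the tree gains two arcs with each further vertex. *)
Lemma connected_arcs e (x0 : T) : symmetric e ->
  (forall x y, connect e x y) -> (2 * #|T| <= #|arcs e| + 2)%N.
Proof.
move=> esym conn.
have T0 : (0 < #|T|)%N by apply/card_gt0P; exists x0.
suff : (2 * #|~: [set x0]| <= #|arcs e|)%N by rewrite cardsC1; lia.
apply: leq_trans (forest_bound esym _) _; last first.
  by apply: subset_leq_card; apply/subsetP=> p; rewrite inE => /andP[].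
move=> L; rewrite sub1set => x0L; rewrite -subTset => /subsetPn[y _ yL].
exact: connect_crossing (conn x0 y) x0L yL.
Qed.

Definition del_edge e (a b : T) : rel T :=
  fun x y => e x y && ((x, y) \notin [:: (a, b); (b, a)]).

Lemma del_edge_sym e a b : symmetric e -> symmetric (del_edge e a b).
Proof.
move=> esym x y; rewrite /del_edge esym !inE !xpair_eqE.
by rewrite orbC !(andbC (x == _)).
Qed.

Lemma card_del_edge e a b : symmetric e -> e a b -> a != b ->
  #|arcs e| = (#|arcs (del_edge e a b)| + 2)%N.
Proof.
move=> esym eab ab.
rewrite -(cardsID [set (a, b); (b, a)] (arcs e)) addnC; congr (_ + _)%N.
  apply: eq_card => -[x y]; rewrite !inE /del_edge /= !inE.
  by rewrite andbC.
suff /setIidPr-> : [set (a, b); (b, a)] \subset arcs e.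
  by rewrite cards2 xpair_eqE negb_and ab.
by apply/subsetP=> p; rewrite !inE => /orP[]/eqP->; rewrite //= esym.
Qed.

(** The rest of the cycle leads from [next s a] back to [a] and replaces the deleted edge in any
    walk. *)
Lemma del_cycle_edge_connect e s a : symmetric e ->
  (2 < size s)%N -> uniq s -> cycle e s -> a \in s ->
  (forall x y, connect e x y) ->
  forall x y, connect (del_edge e a (next s a)) x y.
Proof.
move=> esym s3 us cs sa conn x y.
set b := next s a; set e' := del_edge e a b.
have e'sym : symmetric e' by exact: del_edge_sym.
have e'ba : connect e' b a.
  have [k p Dp] := rot_to sa.
  have Db : b = next (a :: p) a by rewrite /b -Dp next_rot.
  move: s3 us cs; rewrite -(size_rot k) -(rot_uniq k) -(rot_cycle k) Dp.
  case: p {Dp} Db => [|b' [|c p]] //=; rewrite eqxx => <- {b'} _.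
  rewrite !inE !negb_or -!andbA => /and4P[ab ac ap] /and4P[bc bp cp up].
  case/and3P=> eab ebc; rewrite rcons_path => /andP[ecp elast].
  (* Each edge of the path b, c, ..., a has an endpoint in [c :: p], so it is not the deleted
     edge. *)
  have nab z : z \in c :: p -> (z != a) && (z != b).
    rewrite inE => /predU1P[->|zp]; first by rewrite eq_sym ac eq_sym bc.
    by rewrite (contraNneq _ ap) ?(contraNneq _ bp) // => <-.
  apply/connectP; exists (rcons (c :: p) a); last by rewrite last_rcons.
  rewrite /= rcons_path; apply/and3P; split.
  - by rewrite /e' /del_edge ebc !inE !xpair_eqE (eq_sym c b) (negPf bc)
      (eq_sym c a) (negPf ac) !andbF.
  - apply: (@sub_in_path _ [pred z | z \in c :: p] e e') ecp; last exact/allP.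
    move=> u v /nab/andP[ua ub] _ euv.
    by rewrite /e' /del_edge euv !inE !xpair_eqE (negPf ua) (negPf ub).
  - have /andP[ua ub] := nab _ (mem_last c p).
    by rewrite /e' /del_edge elast !inE !xpair_eqE (negPf ua) (negPf ub).
apply: connect_sub (conn x y) => u v euv.
have [uv|uv] := boolP ((u, v) \in [:: (a, b); (b, a)]).
  move: uv; rewrite !inE => /orP[]/eqP[-> ->] //.
  by rewrite (sym_connect_sym e'sym).
by apply: connect1; rewrite /e' /del_edge euv.
Qed.

(** Rotated to start at [x], both sequences list the orbit of [x] under [f]. *)
Lemma fcycle_rot (f : T -> T) s t x : uniq s -> uniq t ->
  fcycle f s -> fcycle f t -> x \in s -> x \in t -> exists k, t = rot k s.
Proof.
move=> us ut fs ft xs xt.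
have := orbitE ft ut xt; rewrite (orbitE fs us xs) => eq_rot.
exists (rot_add s (index x s) (size t - index x t)).
rewrite -rot_rot_add eq_rot -[LHS](rotK (index x t)).
by rewrite /rotr size_rot.
Qed.

(** Membership is required because [next t] fixes every vertex outside [t]. *)
Definition cyc_edge t (a b : T) :=
  [&& a \in t, b \in t & (next t a == b) || (next t b == a)].

(** With at least three vertices [s] cannot turn back, so it runs along [t] in one direction
    throughout: [s] or its reversal is a cycle of [next t]. *)
Lemma cyc_edge_subset_rot s t : (2 < size s)%N -> uniq s -> uniq t ->
  (forall a, a \in s -> cyc_edge t a (next s a)) ->
  exists k, t = rot k s \/ t = rot k (rev s).
Proof.
move=> s3 us ut sub.
have [x sx] : exists x, x \in s.
  by case: s s3 {us sub} => // x s' _; exists x; exact: mem_head.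
have st a : a \in s -> a \in t by case/sub/and3P.
have next2 a : a \in s -> next s (next s a) != a.
  move=> sa; have [k p Dp] := rot_to sa.
  rewrite -!(next_rot k us) Dp.
  move: s3 us; rewrite -(size_rot k) -(rot_uniq k) Dp.
  case: p {Dp} => [|b [|c p]] //= _; rewrite !inE !negb_or -!andbA.
  case/and4P=> ab ac _ _; rewrite !eqxx.
  by rewrite (eq_sym b) (negPf ab) eq_sym.
have fwd a : a \in s -> next s a = next t a ->
    next s (next s a) = next t (next s a).
  move=> sa Ea; have sna : next s a \in s by rewrite mem_next.
  have /and3P[_ _ /orP[/eqP//|/eqP E2]] := sub _ sna.
  case/eqP: (next2 a sa).
  by rewrite -[LHS](prev_next ut) E2 Ea (prev_next ut).
have cycf := cycle_next us.
have [/allP all_fwd|/allPn[y sy ny]] :=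
    boolP (all (fun a => next s a == next t a) s).
  have ft : fcycle (next t) s.
    by apply: (cycle_from_next us) => z /all_fwd; rewrite /= eq_sym.
  have [k ->] := fcycle_rot us ut ft (cycle_next ut) sx (st _ sx).
  by exists k; left.
(* If [s] and [t] agreed at [a], then [fwd] would carry the agreement along [s] to [y], where it
   fails. *)
have bwd a : a \in s -> next s a = prev t a.
  move=> sa; have /and3P[_ _ /orP[/eqP E1|/eqP E2]] := sub _ sa; last first.
    by rewrite -[in RHS]E2 (prev_next ut).
  case/negP: ny; have: fconnect (next s) a y by rewrite (fconnect_cycle cycf).
  move/iter_findex <-; elim: (findex _ _ _) => /= [|m IHm]; first by rewrite E1.
  have sm : iter m (next s) a \in s by elim: m {IHm} => //= m; rewrite mem_next.
  by rewrite (fwd _ sm (eqP IHm)).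
have urs : uniq (rev s) by rewrite rev_uniq.
have ft : fcycle (next t) (rev s).
  apply: (cycle_from_next urs) => z; rewrite mem_rev /= => sz.
  rewrite next_rev //.
  have spz : prev s z \in s by rewrite mem_prev.
  have := bwd _ spz; rewrite (next_prev us) => {1}->.
  by rewrite (next_prev ut).
have rsx : x \in rev s by rewrite mem_rev.
have [k ->] := fcycle_rot urs ut ft (cycle_next ut) rsx (st _ sx).
by exists k; right.
Qed.

(* Delete an edge of s that is not in t, then an edge of t: the graph stays
   connected. *)
Lemma two_cycles_arcs e s t : symmetric e -> irreflexive e ->
  (forall x y, connect e x y) ->
  (2 < size s)%N -> uniq s -> cycle e s ->
  (2 < size t)%N -> uniq t -> cycle e t ->
  ~ (exists k, t = rot k s \/ t = rot k (rev s)) ->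
  (2 * #|T| + 2 <= #|arcs e|)%N.
Proof.
move=> esym eirr conn s3 us cs t3 ut ct nst.
have enext r a (f : rel T) : irreflexive f -> cycle f r -> a \in r ->
    f a (next r a) /\ a != next r a.
  move=> firr cr ra; have fa := next_cycle cr ra; split=> //.
  by apply: contraTneq fa => <-; rewrite firr.
have [a sa nta] : exists2 a, a \in s & ~~ cyc_edge t a (next s a).
  apply/allPn/negP => /allP sub; apply: nst; exact: cyc_edge_subset_rot.
have [c tc] : exists c, c \in t.
  by case: t t3 {ut ct nst nta} => // c t' _; exists c; exact: mem_head.
have [ea na] := enext _ _ _ eirr cs sa.
set e1 := del_edge e a (next s a).
have e1sym : symmetric e1 by exact: del_edge_sym.
have e1irr : irreflexive e1 by move=> x; rewrite /e1 /del_edge eirr.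
have ct1 : cycle e1 t.
  apply: (cycle_from_next ut) => z tz; rewrite /e1 /del_edge (next_cycle ct tz).
  have tnz : next t z \in t by rewrite mem_next.
  apply: contra nta; rewrite !inE /cyc_edge => /orP[]/eqP[za nz].
    by rewrite -nz -za tz tnz eqxx.
  by rewrite -za -nz tz tnz eqxx orbT.
have [ec nc] := enext _ _ _ e1irr ct1 tc.
have conn1 := del_cycle_edge_connect esym s3 us cs sa conn.
have conn2 := del_cycle_edge_connect e1sym t3 ut ct1 tc conn1.
(* The two deletions remove four arcs, and the connected remainder still has at least
   [2 * #|T| - 2]. *)
rewrite (card_del_edge esym ea na) -/e1 (card_del_edge e1sym ec nc).
have := connected_arcs c (del_edge_sym c (next t c) e1sym) conn2; lia.
Qed.

End EdgeCounting.

(** * Signs of polynomials and of Z-matrices on (0, 1) *)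

Section PolynomialSigns.
Variable R : rcfType.
Implicit Types (p q : {poly R}) (a b c : R).

Lemma poly_ge0_at1 p : (forall x : R, 0 < x -> x < 1 -> 0 <= p.[x]) -> 0 <= p.[1].
Proof.
move=> p_ge0; rewrite leNgt; apply/negP => p1.
have Np1 : 0 < - p.[1] by rewrite oppr_gt0.
have [d d_gt0 cont] := poly_cont 1 p Np1.
(* This choice puts [1 - m] both in (0, 1) and within [d] of 1. *)
pose m := Num.min (d / 2) (2^-1 : R).
have m0 : 0 < m by rewrite lt_min; apply/andP; split; lra.
have md : m <= d / 2 by rewrite ge_min lexx.
have mh : m <= 2^-1 by rewrite ge_min lexx orbT.
have dist : `|(1 - m) - 1| < d.
  by rewrite addrAC subrr sub0r normrN gtr0_norm //; lra.
have := cont _ dist; rewrite ltr_norml.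
have : 0 <= p.[1 - m] by apply: p_ge0; lra.
lra.
Qed.

Lemma poly_sign_change p a b : a < b -> 0 < p.[a] -> p.[b] < 0 ->
  exists x, [/\ a < x, x < b & root p x].
Proof.
move=> ab pa pb; have pab : p.[a] * p.[b] < 0 by rewrite pmulr_rlt0.
have [x] := poly_ivtoo (ltW ab) pab.
by rewrite in_itv /= => /andP[ax xb] px; exists x.
Qed.

(* At the first zero of a member of the family all members are still
   nonnegative. *)
Lemma poly_family_gt0 (I : finType) (w : I -> {poly R}) :
  (forall i, 0 < (w i).[0]) ->
  (forall c : R, 0 < c -> c < 1 -> (forall i, 0 <= (w i).[c]) ->
     forall i, (w i).[c] != 0) ->
  forall c : R, 0 < c -> c < 1 -> forall i, 0 < (w i).[c].
Proof.
(* The first root of the product is the first zero of any member. *)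
move=> w0 wnz; set P := \prod_i w i.
have rootP x : root P x = [exists i, root (w i) x].
  rewrite /P rootE horner_prod; apply/idP/existsP => [|[i wi]].
    by rewrite prodf_seq_eq0 => /hasP[i _ wi]; exists i.
  by rewrite (bigD1 i) //= (eqP wi) mul0r.
have w_ge0 c : 0 < c -> (forall x : R, 0 < x -> x < c -> ~~ root P x) ->
    forall i, 0 <= (w i).[c].
  move=> c0 nor i; rewrite leNgt; apply/negP => wc.
  have [x [x0 xc wx]] := poly_sign_change c0 (w0 i) wc.
  by have := nor x x0 xc; rewrite rootP; apply/negP/negPn/existsP; exists i.
have noroot x : 0 < x -> x < 1 -> ~~ root P x.
  move: x; case: (next_rootP P 0 1) => [P0|y _ Py yi nor|c _ _ nor].
  - have /existsP[i] : [exists i, root (w i) 0] by rewrite -rootP P0 root0.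
    by rewrite rootE gt_eqF.
  - move: yi; rewrite in_itv /= => /andP[y0 y1].
    have wy : forall i, 0 <= (w i).[y].
      by apply: w_ge0 => // x x0 xy; apply: nor; rewrite in_itv /= x0.
    have : root P y by rewrite rootE Py.
    by rewrite rootP => /existsP[i]; rewrite rootE (negPf (wnz y y0 y1 wy i)).
  - by move=> x x0 x1; apply: nor; rewrite in_itv /= x0.
move=> c c0 c1 i; have wc : forall i, 0 <= (w i).[c].
  by apply: w_ge0 => // x x0 xc; apply: noroot => //; apply: lt_trans c1.
by rewrite lt_neqAle wc andbT eq_sym wnz.
Qed.

(** Dividing by a common root at 1 lowers the size of the nonzero [w i0], so the process stops. The
    factor [1 - 'X] is positive before 1, so signs pass to the quotients. *)
Lemma factor_common_root1 (I : finType) (w : I -> {poly R}) (i0 : I) :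
  w i0 != 0 -> exists k (q : I -> {poly R}),
    (forall i, w i = q i * (1 - 'X) ^+ k) /\ exists i, (q i).[1] != 0.
Proof.
have [m] := ubnP (size (w i0)); elim: m w => // m IHm w wm wi0.
have [/forallP all0|/forallPn[i wi]] := boolP [forall i, root (w i) 1]; last first.
  by exists 0%N, w; split; [move=> j; rewrite expr0 mulr1 | exists i].
have fac i : exists v, w i == v * (1 - 'X).
  have /factor_theorem[v ->] := all0 i; exists (- v).
  by rewrite polyC1 mulNr -mulrN opprB.
pose v i := xchoose (fac i).
have wv i : w i = v i * (1 - 'X) by apply/eqP; exact: (xchooseP (fac i)).
have v0 : v i0 != 0 by apply: contraNneq wi0; rewrite wv => ->; rewrite mul0r.
have vm : (size (v i0) < m)%N.
  move: wm; rewrite wv -opprB mulrN size_polyN size_Mmonic -?polyC1 ?monicXsubC //.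
  by rewrite size_XsubC addn2 /= ltnS.
have [k [q [vq qn]]] := IHm v vm v0.
exists k.+1, q; split=> // i.
by rewrite wv vq exprSr mulrA.
Qed.

(* Z-matrices that start at the identity and never become singular keep a
   positive left vector u with u Q positive, namely u = 1 adj(Q); dividing out
   the common power of 1 - X gives a nonzero limit at 1. *)
Lemma zmatrix_left_vector (n : nat) (Q : 'M[{poly R}]_n) (i0 : 'I_n) :
  map_mx (horner_eval 0) Q = 1%:M ->
  (forall x : R, 0 < x -> x < 1 -> forall i j, i != j -> (Q i j).[x] <= 0) ->
  (forall x : R, 0 < x -> x < 1 -> \det (map_mx (horner_eval x) Q) != 0) ->
  exists q : 'I_n -> {poly R},
    [/\ forall x : R, 0 < x -> x < 1 -> forall i, 0 <= (q i).[x],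
        forall x : R, 0 < x -> x < 1 ->
          forall j, 0 <= (\sum_i q i * Q i j).[x]
      & exists i, (q i).[1] != 0].
Proof.
move=> Q0 Qle0 detQ.
have detE x : \det (map_mx (horner_eval x) Q) = (\det Q).[x].
  by rewrite det_map_mx.
have det_gt0 x : 0 < x -> x < 1 -> 0 < (\det Q).[x].
  move=> x0 x1; rewrite lt_neqAle eq_sym -detE detQ //= detE leNgt.
  apply/negP => dx.
  have d0 : 0 < (\det Q).[0] by rewrite -detE Q0 det1.
  have [y [y0 yx /eqP dy]] := poly_sign_change x0 d0 dx.
  by have := detQ y y0 (lt_trans yx x1); rewrite detE dy eqxx.
pose w j := \sum_i \adj Q i j.
have wQ j : \sum_i w i * Q i j = \det Q.
  transitivity (\sum_k (\adj Q *m Q) k j).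
    under [RHS]eq_bigr => k _ do rewrite mxE.
    by rewrite exchange_big; apply: eq_bigr => i _; rewrite mulr_suml.
  rewrite mul_adj_mx (bigD1 j) //= mxE eqxx mulr1n big1 ?addr0 // => k kj.
  by rewrite mxE (negPf kj).
have w0 j : (w j).[0] = 1.
  rewrite /w horner_sum.
  have adjE k : (\adj Q k j).[0] = (k == j)%:R.
    have -> : (\adj Q k j).[0] = map_mx (horner_eval 0) (\adj Q) k j.
      by rewrite [RHS]mxE.
    by rewrite map_mx_adj Q0 adj1 mxE.
  rewrite (bigD1 j) //= adjE eqxx big1 ?addr0 // => k kj.
  by rewrite adjE (negPf kj).
have w_gt0 : forall c : R, 0 < c -> c < 1 -> forall i, 0 < (w i).[c].
  apply: poly_family_gt0 => [i|c c0 c1 wc j]; first by rewrite w0.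
  apply/negP => /eqP wj; have := det_gt0 c c0 c1.
  rewrite -(wQ j) horner_sum; apply/negP; rewrite -leNgt.
  apply: sumr_le0 => i _; rewrite hornerM.
  have [->|ij] := eqVneq i j; first by rewrite wj mul0r.
  by apply: mulr_ge0_le0; rewrite ?wc // Qle0.
have wi0 : w i0 != 0.
  by apply/eqP => E; have := w0 i0; rewrite E horner0 => /eqP; rewrite eq_sym oner_eq0.
have [k [q [wq qn]]] := factor_common_root1 wi0.
have pk (x : R) : x < 1 -> 0 < (1 - x) ^+ k by move=> x1; rewrite exprn_gt0 ?subr_gt0.
have wqx i x : (w i).[x] = (q i).[x] * (1 - x) ^+ k.
  by rewrite wq hornerM horner_exp !hornerE.
exists q; split=> // x x0 x1 j.
  by rewrite -(pmulr_lge0 _ (pk x x1)) -wqx ltW // w_gt0.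
rewrite -(pmulr_lge0 _ (pk x x1)).
suff -> : (\sum_i q i * Q i j).[x] * (1 - x) ^+ k = (\det Q).[x].
  by rewrite ltW // det_gt0.
rewrite -(wQ j) !horner_sum mulr_suml; apply: eq_bigr => i _.
by rewrite !hornerM wqx mulrAC.
Qed.

End PolynomialSigns.

(** * Entries of [Mtau] and the graph of reciprocal edges *)

Definition recip (n : nat) (E : rel 'I_n) : rel 'I_n :=
  fun i j => E i j && E j i.

Definition recip_closed (n : nat) (E : rel 'I_n) (W : {set 'I_n}) :=
  forall i j, recip E i j -> (i \in W) = (j \in W).

Section MtauEntries.
Variables (n : nat) (E : rel 'I_n).

(** S and D are the adjacency and degree matrices of [recip E]. This grouping isolates the factor
    that vanishes at [tau * t = 1]. *)
Lemma MtauE (R : comNzRingType) (tau t : R) i j : Mtau E tau t i j =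
  (1 - (tau * t) ^+ 2) * ((i == j)%:R - t * (E i j)%:R)
  + tau * t ^+ 2 * ((i == j)%:R * \sum_k (recip E i k)%:R)
  - tau ^+ 2 * t ^+ 3 * (recip E i j)%:R.
Proof.
rewrite /Mtau /adjmx /symmx /diagsq !mxE.
under eq_bigr => k _ do rewrite !mxE -natrM mulnb.
rewrite -natrM mulnb -/(recip E i j) -(mulr_natr tau).
set d := \sum_k _; ring.
Qed.

Lemma map_Mtau (R R' : comNzRingType) (f : {rmorphism R -> R'}) (tau t : R) :
  map_mx f (Mtau E tau t) = Mtau E (f tau) (f t).
Proof.
apply/matrixP => i j; rewrite mxE !MtauE.
rewrite !(rmorphD, rmorphB, rmorphN, rmorphM, rmorphXn, rmorph1, rmorph_nat).
rewrite rmorph_sum; congr (_ + _ * (_ * _) - _).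
by apply: eq_bigr => k _; rewrite rmorph_nat.
Qed.

(** On the indicator vector of a closed [W] the matrices D and S agree, so the last two terms of
    [MtauE] combine and a factor [1 - tau * t] comes out. *)
Lemma Mtau_sum_closed (R : comNzRingType) (tau t : R) (W : {set 'I_n}) i :
  recip_closed E W ->
  \sum_(j in W) Mtau E tau t i j =
  (1 - tau * t) * ((1 + tau * t) *
      ((i \in W)%:R - t * \sum_j (E i j && (j \in W))%:R)
    + tau * t ^+ 2 * \sum_j (recip E i j && (j \in W))%:R).
Proof.
move=> Wcl.
have sumW (F : 'I_n -> bool) :
    \sum_(j in W) (F j)%:R = \sum_j (F j && (j \in W))%:R :> R.
  rewrite big_mkcond /=; apply: eq_bigr => j _.
  by case: (j \in W); rewrite ?andbT ?andbF.
have sumd : \sum_(j in W) (i == j)%:R = (i \in W)%:R :> R.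
  have [iW|iW] := boolP (i \in W).
    by rewrite (bigD1 i) //= eqxx big1 ?addr0 // => j /andP[_ /negPf];
      rewrite eq_sym => ->.
  by rewrite big1 // => j jW; case: eqP iW => // ->; rewrite jW.
have sumr : (i \in W)%:R * (\sum_k (recip E i k)%:R)
    = \sum_j (recip E i j && (j \in W))%:R :> R.
  rewrite mulr_sumr; apply: eq_bigr => k _; rewrite -natrM mulnb andbC.
  by have [/Wcl->|] := boolP (recip E i k).
under eq_bigr => j _ do rewrite MtauE.
rewrite sumrB big_split /= -!mulr_sumr sumrB -!mulr_sumr -mulr_suml sumd !sumW.
by rewrite sumr; ring.
Qed.

End MtauEntries.

(** * From a nonnegative left vector to an edge bound *)

Section EdgeBound.
Variables (R : realFieldType) (n : nat) (E : rel 'I_n).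
Implicit Types W : {set 'I_n}.

Definition into W : rel 'I_n :=
  fun i j => E i j && (j \in W) || E j i && (i \in W).

(** Inclusion-exclusion over the two disjuncts of [into]: both hold for a reciprocal pair inside
    [W], and closure makes one endpoint in [W] enough. *)
Lemma card_arcs_into W : recip_closed E W ->
  (#|arcs (into W)|%:R : R) =
    \sum_i (2 * (\sum_j (E i j && (j \in W))%:R)
            - \sum_j (recip E i j && (j \in W))%:R).
Proof.
move=> Wcl; rewrite card_arcs natr_sum sumrB -mulr_sumr mulr_natl mulr2n.
rewrite [X in _ + X - _]exchange_big /= -big_split -sumrB /=.
apply: eq_bigr => i _; rewrite natr_sum -big_split -sumrB /=.
apply: eq_bigr => j _; rewrite /into /recip; have := Wcl i j; rewrite /recip.
case: (E i j); case: (E j i) => /= Wij; first rewrite (Wij isT).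
all: by do ?case: (_ \in _) => /=; lra.
Qed.

(** Forest growth from the complement of [W]: an arc of [E] leaving a larger set has its head in
    [W], hence lies in [into W]. *)
Lemma into_bound W : strongly_connected E -> W != setT ->
  (2 * #|W| <= #|arcs (into W)|)%N.
Proof.
move=> sc; rewrite -subTset => /subsetPn[x _ xW].
rewrite -{1}[W]setCK; apply: leq_trans (@forest_bound _ (into W) _ _ _) _; last first.
- by apply: subset_leq_card; apply/subsetP=> p; rewrite inE => /andP[].
- move=> L KL; rewrite -subTset => /subsetPn[y _ yL].
  have xL : x \in L by apply: (subsetP KL); rewrite inE.
  have [i [j [iL jL eij]]] := connect_crossing (sc x y) xL yL.
  exists i, j; split=> //; rewrite /into eij /=.
  have : j \notin ~: W by apply: contra jL; apply: (subsetP KL).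
  by rewrite inE negbK => ->.
- by move=> i j; rewrite /into orbC.
Qed.

(** The two inequalities on [u] are what survives at [tau * t = 1]: the value of u M, and the
    first-order term of u M applied to the indicator of [W]. They are exploited on the set where [u]
    is minimal. *)
Lemma undir_arcs_bound (u : 'I_n -> R) : loopless E -> strongly_connected E ->
  (forall i, 0 <= u i) -> (exists i, u i != 0) ->
  (forall j, \sum_i u i * (recip E i j)%:R <= u j * \sum_k (recip E j k)%:R) ->
  (forall W, recip_closed E W ->
     0 <= \sum_i u i * (2 * (i \in W)%:R
       + \sum_j (recip E i j && (j \in W))%:R
       - 2 * \sum_j (E i j && (j \in W))%:R)) ->
  (#|arcs (undir E)| <= 2 * n)%N.
Proof.
move=> loop sc u_ge0 [i1 ui1] Hrec HW.
pose i0 := [arg min_(i < i1) u i]%O.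
have umin i : u i0 <= u i.
  by rewrite /i0; case: Order.TotalTheory.arg_minP => // k _ /(_ i isT).
pose W := [set i | u i == u i0].
have recipC i j : recip E i j = recip E j i by rewrite /recip andbC.
(* At a minimum [j] the hypothesis says that the sum of [u j - u k] over reciprocal neighbours [k]
   is nonnegative. No term is positive, so all vanish. *)
have half i j : j \in W -> recip E i j -> i \in W.
  rewrite !inE => /eqP uj rij; rewrite eq_le umin andbT -uj -subr_ge0.
  have := Hrec j; rewrite mulr_sumr -subr_ge0 -sumrB.
  rewrite (bigD1 i) //= recipC rij !mulr1 => H; apply: le_trans H _.
  rewrite gerDl; apply: sumr_le0 => k _; rewrite recipC -mulrBl.
  by rewrite mulr_le0_ge0 // uj subr_le0.
have Wcl : recip_closed E W.
  move=> i j rij; apply/idP/idP => [iW|jW]; last exact: half rij.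
  by apply: half iW _; rewrite recipC.
pose a i : R := \sum_j (E i j && (j \in W))%:R.
pose r i : R := \sum_j (recip E i j && (j \in W))%:R.
have a_ge0 i : 0 <= a i by apply: sumr_ge0 => j _; exact: ler0n.
have cardW : #|W|%:R = \sum_i (i \in W)%:R :> R.
  by rewrite -sum1_card natr_sum big_mkcond; apply: eq_bigr => i _; case: ifP.
(* Split [u] as [u i0] plus the excess. The excess vanishes on [W]; off [W] both the indicator and
   [r] vanish, which leaves only [a]. *)
have split_u : 0 <= u i0 * (2 * #|W|%:R - #|arcs (into W)|%:R)
    - 2 * \sum_i (u i - u i0) * a i.
  apply: le_trans (HW W Wcl) _; rewrite le_eqVlt; apply/orP; left; apply/eqP.
  rewrite (card_arcs_into Wcl) cardW !mulr_sumr -sumrB mulr_sumr -sumrB.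
  apply: eq_bigr => i _; rewrite -/(a i) -/(r i).
  have [iW|iW] := boolP (i \in W).
    by move: (iW); rewrite inE => /eqP->; ring.
  have -> : r i = 0.
    rewrite /r big1 // => j _; have [/Wcl Eij|//] := boolP (recip E i j).
    by rewrite -Eij (negPf iW).
  by rewrite mulr0n; ring.
have sum_ge0 : 0 <= \sum_i (u i - u i0) * a i.
  by apply: sumr_ge0 => i _; rewrite mulr_ge0 // subr_ge0.
have [WT|WnT] := eqVneq W setT; last first.
  exfalso; have := into_bound sc WnT; rewrite -(ler_nat R) natrM => bnd.
  have [x _ xW] := subsetPn (contra (fun h => etrans (esym (subTset _)) h) WnT).
  have i0W : i0 \in W by rewrite inE.
  have i0C : i0 \notin ~: W by rewrite inE negbK.
  have xC : x \in ~: W by rewrite inE.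
  (* At the tail of an arc entering [W] both the excess of [u] and [a] are positive, so [split_u]
     would have a negative right-hand side. *)
  have [i [j []]] := connect_crossing (sc x i0) xC i0C.
  rewrite !inE negbK => iW jW Eij.
  have ui : 0 < u i - u i0 by rewrite subr_gt0 lt_neqAle umin eq_sym iW.
  have ai : 0 < a i.
    rewrite /a (bigD1 j) //= Eij inE jW ltr_pwDl ?ltr01 //.
    by apply: sumr_ge0 => k _; exact: ler0n.
  have : 0 < \sum_i (u i - u i0) * a i.
    rewrite (bigD1 i) //= ltr_pwDl ?mulr_gt0 //.
    by apply: sumr_ge0 => k _; rewrite mulr_ge0 // subr_ge0.
  have : u i0 * (2 * #|W|%:R - #|arcs (into W)|%:R) <= 0.
    by rewrite mulr_ge0_le0 // subr_le0.
  lra.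
have u0 : 0 < u i0.
  rewrite lt_neqAle u_ge0 andbT eq_sym.
  have : i1 \in W by rewrite WT inE.
  by rewrite inE => /eqP <-.
(* For [W] the whole vertex set, [into W] and [undir E] can differ only at loops. *)
have -> : #|arcs (undir E)| = #|arcs (into W)|.
  rewrite !card_arcs; apply: eq_bigr => i _; apply: eq_bigr => j _.
  rewrite /undir /into WT !inE !andbT; case: eqP => // ->.
  by rewrite (negPf (loop j)).
rewrite -(ler_nat R) natrM -subr_ge0 -(pmulr_rge0 _ u0).
by move: split_u; rewrite WT cardsT card_ord -WT; lra.
Qed.

End EdgeBound.

(** * The two edge counts collide *)

Lemma two_cycles_undir_arcs (n : nat) (E : rel 'I_n) :
  strongly_connected E -> two_cycles E -> (2 * n + 2 <= #|arcs (undir E)|)%N.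
Proof.
move=> sc [s [t [/and3P[s3 us cs] /and3P[t3 ut ct] nst]]].
have usym : symmetric (undir E) by move=> i j; rewrite /undir eq_sym orbC.
have uirr : irreflexive (undir E) by move=> i; rewrite /undir eqxx.
rewrite -{1}(card_ord n).
apply: two_cycles_arcs s3 us cs t3 ut ct nst => // x y.
apply: connect_sub (sc x y) => i j Eij.
have [->|ij] := eqVneq i j; first exact: connect0.
by apply: connect1; rewrite /undir ij Eij.
Qed.

Theorem theorem4p12 (R : realType) (n : nat) (E : rel 'I_n) (tau : R) :
  loopless E -> strongly_connected E ->
  0 < tau -> tau <= 1 ->
  two_cycles E ->
  exists t : R, [/\ 0 < t, t < tau^-1 & \det (Mtau E tau t) = 0].
Proof.
move=> loop sc tau0 tau1 cyc2; apply: boolp.contrapT => noroot.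
have [i0 _] : exists i : 'I_n, true.
  by case: cyc2 => -[|i s] [t [/and3P[]]] //; exists i.
have tauV : tau * tau^-1 = 1 by rewrite mulfV // gt_eqF.
have tauV0 : 0 < tau^-1 by rewrite invr_gt0.
(* The indeterminate stands for [tau * t], which rescales the interval to (0, 1). *)
pose Q : 'M[{poly R}]_n := Mtau E tau%:P (tau^-1 *: 'X).
have QE x : map_mx (horner_eval x) Q = Mtau E tau (tau^-1 * x).
  by rewrite map_Mtau /= /horner_eval !hornerE.
have QEij x i j : (Q i j).[x] = Mtau E tau (tau^-1 * x) i j.
  by rewrite -QE [RHS]mxE.
have [||| q [q_ge0 qQ [i1 qi1]]] := @zmatrix_left_vector R n Q i0.
- rewrite QE mulr0; apply/matrixP => i j; rewrite MtauE mxE mulr0.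
  by rewrite !expr0n /= !(mulr0, mul0r, subr0, addr0, mul1r).
- move=> x x0 x1 i j ij; rewrite QEij MtauE (negPf ij) mul0r mulr0 addr0.
  rewrite mulrA tauV mul1r sub0r.
  have x2 : 0 <= 1 - x ^+ 2 by rewrite subr_ge0 expr_le1 // ltW.
  have xW := ltW x0; have tauVW := ltW tauV0.
  have A0 : 0 <= (1 - x ^+ 2) * (tau^-1 * x * (E i j)%:R).
    by rewrite !mulr_ge0 ?ler0n.
  have S0 : 0 <= tau ^+ 2 * (tau^-1 * x) ^+ 3 * (recip E i j)%:R.
    by rewrite !mulr_ge0 ?ler0n ?exprn_ge0 ?mulr_ge0 ?(ltW tau0).
  by rewrite mulrN; lra.
- move=> x x0 x1; rewrite QE; apply/eqP => dQ; apply: noroot.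
  exists (tau^-1 * x); split=> //; first by rewrite mulr_gt0.
  by rewrite -[ltRHS]mulr1 ltr_pM2l.
pose u i := (q i).[1].
have u_ge0 i : 0 <= u i by apply: poly_ge0_at1 => x x0 x1; exact: q_ge0.
suff : (#|arcs (undir E)| <= 2 * n)%N.
  by have := two_cycles_undir_arcs sc cyc2; lia.
apply: (undir_arcs_bound (u := u)) => //; first by exists i1.
(* At 1 the term with I - tA drops out and [Q] becomes [tau^-1] times D - S. *)
- move=> j; have := poly_ge0_at1 (fun x x0 x1 => qQ x x0 x1 j).
  rewrite horner_sum.
  have QE1 i : (q i * Q i j).[1] = tau^-1 *
      ((if i == j then u i * \sum_k (recip E i k)%:R else 0)
        - u i * (recip E i j)%:R).
    rewrite hornerM QEij mulr1 MtauE tauV -/(u i).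
    have -> : tau * tau^-1 ^+ 2 = tau^-1 by rewrite expr2 mulrA tauV mul1r.
    have -> : tau ^+ 2 * tau^-1 ^+ 3 = tau^-1.
      by rewrite [tau^-1 ^+ 3]exprSr mulrA -exprMn tauV expr1n mul1r.
    by case: eqP => _; rewrite ?mul0r ?mul1r; ring.
  under eq_bigr => i _ do rewrite QE1.
  rewrite -mulr_sumr pmulr_rge0 // sumrB -big_mkcond big_pred1_eq /= subr_ge0.
  by [].
- move=> W Wcl.
  pose a i : R := \sum_j (E i j && (j \in W))%:R.
  pose r i : R := \sum_j (recip E i j && (j \in W))%:R.
  (* The quotient by [1 - 'X] of the row sum of [Q] over [W]; its value at 1 is the first-order
     term. *)
  pose G i : {poly R} := (1 + 'X) * ((i \in W)%:R%:P - (tau^-1 * a i) *: 'X)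
                         + (tau^-1 * r i) *: 'X^2.
  have GE x i : (\sum_(j in W) Q i j).[x] = (1 - x) * (G i).[x].
    rewrite horner_sum; under eq_bigr => j _ do rewrite QEij.
    rewrite (Mtau_sum_closed _ _ _ Wcl) -/(a i) -/(r i) mulrA tauV mul1r /G.
    rewrite !hornerE /=.
    by rewrite tauV; ring.
  have : 0 <= (\sum_i q i * G i).[1].
    apply: poly_ge0_at1 => x x0 x1.
    have x1' : 0 < 1 - x by rewrite subr_gt0.
    rewrite -(pmulr_rge0 _ x1').
    have -> : (1 - x) * (\sum_i q i * G i).[x] =
        \sum_(j in W) (\sum_i q i * Q i j).[x].
      rewrite -horner_sum exchange_big /= !horner_sum mulr_sumr.
      apply: eq_bigr => i _; rewrite -mulr_sumr !hornerM GE.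
      by rewrite mulrCA.
    by apply: sumr_ge0 => j _; exact: qQ.
  rewrite -(pmulr_rge0 _ tau0) horner_sum mulr_sumr => H.
  apply: le_trans H _; apply: ler_sum => i _.
  rewrite hornerM -/(u i) -/(a i) -/(r i) mulrCA ler_wpM2l //.
  rewrite /G !hornerE /= !mulr1.
  have iW : 0 <= ((i \in W)%:R : R) by exact: ler0n.
  (* Here [tau <= 1] enters: it bounds the coefficient [2 * tau] of the indicator by 2, as the edge
     count requires. *)
  have tW : tau * (i \in W)%:R <= (i \in W)%:R by rewrite ler_piMl.
  have ta : tau * (tau^-1 * a i) = a i by rewrite mulrA tauV mul1r.
  have tr : tau * (tau^-1 * r i) = r i by rewrite mulrA tauV mul1r.
  have -> : tau * ((1 + 1) * ((i \in W)%:R - tau^-1 * a i) + tau^-1 * r i) =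
     2 * (tau * (i \in W)%:R) - 2 * (tau * (tau^-1 * a i))
     + tau * (tau^-1 * r i) by ring.
  rewrite ta tr; lra.
Qed.
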